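(* Let $k\ge 3$ be an integer, let $I$ be a non-degenerate interval of the real line, and let $f:I\to I$ be continuous. If $\mathbf B=\{\beta_1<\beta_2<\cdots<\beta_{2k+1}\}$ is a second minimal $(2k+1)$-orbit of $f$, then $\mathbf B$ is simple.
   Context: A point $c\in I$ is periodic with period $m$ if $f^m(c)=c$ and $f^l(c)\ne c$ for $1\le l<m$; the set of $m$ distinct points $\{c,f(c),\dots,f^{m-1}(c)\}$ is then called an $m$-orbit of $f$. Second minimal orbits: a $(2k+1)$-orbit $\{\beta_1<\cdots<\beta_{2k+1}\}$ of $f$, $k\ge 3$, is called second minimal if $2k-1$ is the minimal period of the restriction $f|_{[\beta_1,\beta_{2k+1}]}$ in the Sharkovski ordering $$1\triangleleft 2\triangleleft 2^2\triangleleft 2^3\triangleleft\cdots\triangleleft 2^2\cdot 5\triangleleft 2^2\cdot 3\triangleleft\cdots\triangleleft 2\cdot 5\triangleleft 2\cdot 3\triangleleft\cdots\triangleleft 9\triangleleft 7\triangleleft 5\triangleleft 3 .$$ This means that $f$ has a periodic orbit of period $2k-1$ contained in $[\beta_1,\beta_{2k+1}]$, and has no periodic orbit contained in $[\beta_1,\beta_{2k+1}]$ whose period is an odd integer $q$ with $1<q<2k-1$ (that is, among the periods of orbits of $f$ contained in $[\beta_1,\beta_{2k+1}]$, $2k-1$ is the one standing furthest toward the end ''$3$'' of the displayed ordering). Simple orbits: for $1\le i\le j\le 2k+1$ put $B(i,j)=\{\beta_l : i\le l\le j\}$. The $(2k+1)$-orbit is called simple if at least one of the following holds: (1) (type $+$)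 $f$ maps $B(k+2,2k+1)$ into $B(1,k+1)$, and $f$ maps all points of $B(1,k+1)$ except one into $B(k+2,2k+1)$; (2) (type $-$) $f$ maps $B(1,k)$ into $B(k+1,2k+1)$, and $f$ maps all points of $B(k+1,2k+1)$ except one into $B(1,k)$. *)

(* Defs.v *)
From mathcomp Require Import all_boot all_order all_algebra.
From mathcomp Require Import all_classical all_reals all_analysis.
From mathcomp Require Import zify.
Set Implicit Arguments.
Unset Strict Implicit.
Unset Printing Implicit Defensive.
Import Order.TTheory GRing.Theory Num.Theory.
Import numFieldNormedType.Exports.
Local Open Scope classical_set_scope.
Local Open Scope ring_scope.

(* A map f : I -> I is represented by a total function f : R -> R preserving
   the set I; its values outside I are never used. *)

Definition periodic_point (R : realType) (I : set R) (f : R -> R)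
    (m : nat) (c : R) : Prop :=
  [/\ I c, (1 <= m)%N, iter m f c = c &
      forall l : nat, (1 <= l < m)%N -> iter l f c <> c].

Definition is_orbit (R : realType) (I : set R) (f : R -> R)
    (m : nat) (O : set R) : Prop :=
  exists2 c, periodic_point I f m c &
    O = [set iter j f c | j in [set j : nat | (j < m)%N]].

(* m is a period of the restriction of f to J: since J need not be invariant,
   this means that some m-orbit of f is contained in J. *)
Definition period_in (R : realType) (I : set R) (f : R -> R)
    (J : set R) (m : nat) : Prop :=
  exists2 O, is_orbit I f m O & O `<=` J.

(* [sharkovski m n] is the strict relation m <| n of the Sharkovski ordering
     1 <| 2 <| 2^2 <| ... <| 2^2 * 5 <| 2^2 * 3 <| ... <| 2 * 5 <| 2 * 3
       <| ... <| 7 <| 5 <| 3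
   on positive integers, with m = 2 ^ a * p and n = 2 ^ b * q, p and q odd. *)
Definition sharkovski (m n : nat) : bool :=
  let a := logn 2 m in let p := (m`_2^')%N in
  let b := logn 2 n in let q := (n`_2^')%N in
  if p == 1%N then (q != 1%N) || (a < b)%N
  else (q != 1%N) && ((b < a)%N || ((a == b) && (q < p)%N)).

(* The "minimal" period in the Sharkovski ordering is the one standing furthest
   toward the end 3, i.e. the greatest one for <|. *)
Definition sharkovski_minimal_period (R : realType) (I : set R) (f : R -> R)
    (J : set R) (m : nat) : Prop :=
  period_in I f J m /\
  forall n : nat, period_in I f J n -> n <> m -> sharkovski n m.

(* beta_1 < ... < beta_n is stored as beta : 'I_n -> R, so that beta_l is
   [beta i] with i.+1 = l; [block] below keeps the 1-based numbering. *)
Definition increasing_orbit (R : realType) (I : set R) (f : R -> R)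
    (n : nat) (beta : 'I_n -> R) : Prop :=
  {homo beta : i j / (i < j)%N >-> i < j} /\ is_orbit I f n (range beta).

Definition second_minimal (R : realType) (I : set R) (f : R -> R)
    (k : nat) (beta : 'I_(2 * k).+1 -> R) : Prop :=
  [/\ (3 <= k)%N, increasing_orbit I f beta &
      sharkovski_minimal_period I f `[beta ord0, beta ord_max] (2 * k - 1)].

Definition block (R : realType) (n : nat) (beta : 'I_n -> R)
    (i j : nat) : set R :=
  [set beta l | l in [set l : 'I_n | (i <= l.+1 <= j)%N]].

Definition maps_all_but_one (R : realType) (f : R -> R) (A B : set R) : Prop :=
  exists x, [/\ A x, ~ B (f x) & forall y, A y -> y <> x -> B (f y)].

Definition simple_plus (R : realType) (f : R -> R)
    (k : nat) (beta : 'I_(2 * k).+1 -> R) : Prop :=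
  set_fun (block beta (k + 2) (2 * k + 1)) (block beta 1 (k + 1)) f /\
  maps_all_but_one f (block beta 1 (k + 1)) (block beta (k + 2) (2 * k + 1)).

Definition simple_minus (R : realType) (f : R -> R)
    (k : nat) (beta : 'I_(2 * k).+1 -> R) : Prop :=
  set_fun (block beta 1 k) (block beta (k + 1) (2 * k + 1)) f /\
  maps_all_but_one f (block beta (k + 1) (2 * k + 1)) (block beta 1 k).

Definition simple_orbit (R : realType) (f : R -> R)
    (k : nat) (beta : 'I_(2 * k).+1 -> R) : Prop :=
  simple_plus f beta \/ simple_minus f beta.

Lemma sharkovski_oddr (n q : nat) : (0 < n)%N -> odd q -> (1 < q)%N ->
  sharkovski n q = ~~ (odd n && (1 < n <= q)%N).
Proof.
move=> n0 oq q1; rewrite /sharkovski.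
have q2 : (q`_2^' = q)%N by apply: part_pnat_id; rewrite -odd_2'nat.
have lq : logn 2 q = 0%N by rewrite lognE dvdn2 oq andbF.
rewrite q2 lq ltn0 orbF; have -> : (q != 1)%N by lia.
case: (boolP (odd n)) => on /=.
  have -> : (n`_2^' = n)%N by apply: part_pnat_id; rewrite -odd_2'nat.
  have -> : logn 2 n = 0%N by rewrite lognE dvdn2 on andbF.
  by case: eqP => [->//|n1]; rewrite ltnn eqxx /=; lia.
have : (0 < logn 2 n)%N by rewrite logn_gt0 mem_primes n0 dvdn2 on.
by case: eqP => //= _ ->.
Qed.

Lemma sharkovski_minimal_periodE (R : realType) (I : set R) (f : R -> R)
    (J : set R) (k : nat) : (2 <= k)%N ->
  sharkovski_minimal_period I f J (2 * k - 1) <->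
  period_in I f J (2 * k - 1) /\
  forall q : nat, odd q -> (1 < q < 2 * k - 1)%N -> ~ period_in I f J q.
Proof.
move=> k2; have ok : odd (2 * k - 1) by lia.
split=> -[pk H]; split=> // q.
  move=> oq q1 pq; have /(H _ pq) : q <> (2 * k - 1)%N by lia.
  by rewrite sharkovski_oddr ?oq //=; lia.
move=> pq qk; have q0 : (0 < q)%N by case: pq => O [c [_ ? _ _] _].
rewrite sharkovski_oddr //; last by lia.
by apply/negP => /andP[oq q1]; apply: (H q) => //; lia.
Qed.

(* Main.v *)
(** The map permutes the orbit points, and a closed chain of [q] intervals
    spanned by orbit points, each covered by the image of the previous one,
    yields [x] with [f^q x = x]. If [q <= 2k-3] is odd and two of the intervals
    meet in at most one point, [x] is not fixed (an orbit point is not fixed), so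
    its period is odd, between 3 and [2k-3], which second minimality forbids.

    Choose consecutive orbit points [c], [c+1] that [f] carries across each other,
    and let [H_0 = [c, c+1]] and [H_(m+1)] be the hull of the image of the orbit
    points in [H_m]. These hulls strictly increase until they contain the whole
    orbit. In [H_(2k-4)], which has at least [2k-2] points, every point changes
    side with respect to the cut: otherwise two neighbours [y], [y+1] in it cover
    [H_0], and [H_0, ..., H_(2k-5), [y, y+1], H_0] is a forbidden loop of length
    [2k-3]. Hence at most three points keep their side, and their number is odd.
    If it is one, a count gives a cut in the middle and the orbit is simple.

    If it is three, the last hulls grow by exactly one point, the cut halves
    [H_(2k-4)], and the three points are those outside it. Up to reflection at
    least two of them lie on the left. If exactly two do, they are swapped, which
    is impossible for a cycle. If all three do, they form a segment of the cycle
    leaving from the rightmost point, and each of the six possible orders of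
    visit produces a forbidden loop of length 3. *)

Require Import Defs.
From mathcomp Require Import all_boot all_order all_algebra.
From mathcomp Require Import all_classical all_reals all_analysis.
From mathcomp Require Import zify.
Set Implicit Arguments.
Unset Strict Implicit.
Unset Printing Implicit Defensive.
Import Order.TTheory GRing.Theory Num.Theory.
Import numFieldNormedType.Exports.

Local Open Scope nat_scope.

(** * Permutations of an odd number of points without short odd loops *)

(** By the intermediate value theorem, the image of one interval under [f] then contains the other;
    orbit points serve as witnesses, so only [p] matters. *)
Definition covers (p : nat -> nat) (a b c d : nat) : Prop :=
  exists u v, [/\ a <= u <= b, a <= v <= b, p u <= c & d <= p v].

(* [p] permutes [{0, ..., 2k}] as [f] permutes the orbit, and [adm_loop] is
   what remains of the absence of odd periods below [2k-1]: the intervals of a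
   short odd loop overlap pairwise, so the loop may only detect a fixed point. *)
Record admissible (k : nat) (p : nat -> nat) : Prop := Admissible {
  adm_bound : forall i, i <= 2 * k -> p i <= 2 * k;
  adm_inj : forall i j, i <= 2 * k -> j <= 2 * k -> p i = p j -> i = j;
  adm_cyclic : forall S : nat -> bool, (exists2 i, i <= 2 * k & S i) ->
    (forall i, i <= 2 * k -> S i -> S (p i)) -> forall i, i <= 2 * k -> S i;
  adm_loop : forall q (lo hi : nat -> nat), odd q -> 1 < q < 2 * k - 1 ->
    (forall t, t <= q -> lo t <= hi t <= 2 * k) ->
    (forall t, t < q -> covers p (lo t) (hi t) (lo t.+1) (hi t.+1)) ->
    lo q = lo 0 -> hi q = hi 0 ->
    forall s t, s <= q -> t <= q -> lo t < hi s }.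

(** Length 3 lies below [2 * k - 1] because [3 <= k]. Only the first two intervals are compared, so
    the third may repeat one of them. *)
Lemma admissible_loop3 (k : nat) (p : nat -> nat) (a0 b0 a1 b1 a2 b2 : nat) :
  3 <= k -> admissible k p ->
  a0 <= b0 <= 2 * k -> a1 <= b1 <= 2 * k -> a2 <= b2 <= 2 * k ->
  covers p a0 b0 a1 b1 -> covers p a1 b1 a2 b2 -> covers p a2 b2 a0 b0 ->
  a1 < b0 /\ a0 < b1.
Proof.
move=> k3 adm h0 h1 h2 c0 c1 c2.
pose lo := nth 0 [:: a0; a1; a2; a0]; pose hi := nth 0 [:: b0; b1; b2; b0].
have loop := adm_loop adm (q := 3) (lo := lo) (hi := hi).
by split; [apply: (loop _ _ _ _ _ _ 0 1)|apply: (loop _ _ _ _ _ _ 1 0)];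
  rewrite //; try lia; case=> [|[|[|[|]]]].
Qed.

Definition mirror (k : nat) (p : nat -> nat) (i : nat) : nat :=
  2 * k - p (2 * k - i).

(** Reflection turns right ends into left ends, and the two witnesses of each covering trade
    places. *)
Lemma admissible_mirror (k : nat) (p : nat -> nat) :
  admissible k p -> admissible k (mirror k p).
Proof.
move=> adm; have bnd := adm_bound adm.
split; rewrite /mirror.
- by move=> i _; lia.
- move=> i j ik jk e.
  have := bnd (2 * k - i); have := bnd (2 * k - j) => h1 h2.
  by have := @adm_inj _ _ adm (2 * k - i) (2 * k - j); lia.
- move=> S [i0 i0k Si0] HS i ik.
  have := @adm_cyclic _ _ adm (fun j => S (2 * k - j)) _ _ (2 * k - i).
  rewrite subKn //; apply; last by lia.
    by exists (2 * k - i0); rewrite ?subKn //; lia.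
  move=> j jk /HS; rewrite subKn //; apply; lia.
- move=> q lo hi oq qk lohi cov loq hiq s t sq tq.
  have := @adm_loop _ _ adm q (fun t => 2 * k - hi t)
    (fun t => 2 * k - lo t) oq qk.
  rewrite loq hiq => /(_ _ _ erefl erefl t s tq sq) => H.
  have := lohi _ sq; have := lohi _ tq.
  suff : 2 * k - hi s < 2 * k - lo t by lia.
  apply: H => r rq; first by have := lohi _ rq; lia.
  have [u [v [hu hv h1 h2]]] := cov _ rq.
  have := bnd (2 * k - u); have := bnd (2 * k - v).
  have := lohi _ (ltnW rq); have := lohi _ rq.
  exists (2 * k - v), (2 * k - u); split; lia.
Qed.

Lemma admissible_no_fixpoint (k : nat) (p : nat -> nat) (i : nat) :
  0 < k -> admissible k p -> i <= 2 * k -> p i <> i.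
Proof.
move=> k0 adm ik pi; have j : (if i == 0 then 1 else 0) == i.
  apply: (adm_cyclic (S := fun j => j == i) adm) => //; first by exists i.
    by move=> j _ /eqP->; apply/eqP.
  by case: ifP; lia.
by move: j; case: ifP; lia.
Qed.

Lemma admissible_perm (k : nat) (p : nat -> nat) : admissible k p ->
  perm_eq [seq p i | i <- iota 0 (2 * k).+1] (iota 0 (2 * k).+1).
Proof.
move=> adm.
have up : uniq [seq p i | i <- iota 0 (2 * k).+1].
  rewrite map_inj_in_uniq ?iota_uniq // => i j.
  by rewrite !mem_iota /= !add0n !ltnS; apply: (adm_inj adm).
have sub : {subset [seq p i | i <- iota 0 (2 * k).+1] <= iota 0 (2 * k).+1}.
  move=> _ /mapP[i + ->]; rewrite !mem_iota /= !add0n !ltnS.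
  exact: (adm_bound adm).
have [|_ eqm] := uniq_min_size up sub; first by rewrite size_map.
by apply: uniq_perm => //; exact: iota_uniq.
Qed.

Lemma admissible_onto (k : nat) (p : nat -> nat) (j : nat) : admissible k p ->
  j <= 2 * k -> exists2 i, i <= 2 * k & p i = j.
Proof.
move=> adm jk; have : j \in [seq p i | i <- iota 0 (2 * k).+1].
  by rewrite (perm_mem (admissible_perm adm)) mem_iota.
by case/mapP=> i; rewrite mem_iota /= add0n ltnS => ik ->; exists i.
Qed.

(** * Hulls of images of integer intervals *)

Definition hull (p : nat -> nat) (s : nat * nat) : nat * nat :=
  let r := [seq p i | i <- iota s.1 (s.2 - s.1).+1] in
  (foldr minn (p s.1) r, foldr maxn (p s.1) r).

Arguments hull : simpl never.

Lemma foldr_minn_spec (x : nat) (s : seq nat) :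
  foldr minn x s \in x :: s /\ {in s, forall y, foldr minn x s <= y}.
Proof.
elim: s => [|y s [IH1 IH2]] /=; first by rewrite mem_head.
split=> [|z]; rewrite !inE in IH1 *.
  rewrite /minn; case: ifP => _; rewrite ?eqxx ?orbT //.
  by case/orP: IH1 => ->; rewrite ?orbT.
by case/predU1P=> [->|/IH2 h]; rewrite geq_min ?leqnn ?h ?orbT.
Qed.

Lemma foldr_maxn_spec (x : nat) (s : seq nat) :
  foldr maxn x s \in x :: s /\ {in s, forall y, y <= foldr maxn x s}.
Proof.
elim: s => [|y s [IH1 IH2]] /=; first by rewrite mem_head.
split=> [|z]; rewrite !inE in IH1 *.
  rewrite /maxn; case: ifP => _; rewrite ?eqxx ?orbT //.
  by case/orP: IH1 => ->; rewrite ?orbT.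
by case/predU1P=> [->|/IH2 h]; rewrite leq_max ?leqnn ?h ?orbT.
Qed.

Lemma hullP (p : nat -> nat) (s : nat * nat) : s.1 <= s.2 ->
  [/\ forall i, s.1 <= i <= s.2 -> (hull p s).1 <= p i <= (hull p s).2,
      exists2 u, s.1 <= u <= s.2 & p u = (hull p s).1 &
      exists2 v, s.1 <= v <= s.2 & p v = (hull p s).2].
Proof.
move=> s12; rewrite /hull; set r := [seq p i | i <- _].
have mem_r y : y \in p s.1 :: r -> exists2 i, s.1 <= i <= s.2 & p i = y.
  rewrite inE => /predU1P[->|/mapP[i]]; first by exists s.1; rewrite ?leqnn.
  by rewrite mem_iota => ik ->; exists i => //; lia.
have [/mem_r minr min_le] := foldr_minn_spec (p s.1) r.
have [/mem_r maxr max_ge] := foldr_maxn_spec (p s.1) r.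
split=> // i i12; have ir : p i \in r by apply: map_f; rewrite mem_iota; lia.
by rewrite min_le ?max_ge.
Qed.


(** * Counting points on either side of a cut *)

Lemma count_sub (a b : pred nat) (s : seq nat) :
  (forall x, x \in s -> a x -> b x) -> count a s <= count b s /\
  (count a s = count b s -> forall x, x \in s -> b x -> a x).
Proof.
elim: s => [|y s IH] //= ab.
have [|le eq] := IH; first by move=> x xs; apply: ab; rewrite inE xs orbT.
have aby := ab y (mem_head _ _).
split; first by case: (a y) aby => [->//|_]; lia.
move=> e; have [ay eqs] : a y = b y /\ count a s = count b s.
  by case: (a y) aby e => [->//|_]; [|case: (b y)] => /= e; split=> //; lia.
by move=> x; rewrite inE => /predU1P[->|/(eq eqs x)//]; rewrite ay.
Qed.

Lemma count_split (a b : pred nat) (s : seq nat) :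
  count a s = count (fun i => a i && b i) s + count (fun i => a i && ~~ b i) s.
Proof. by elim: s => //= y s ->; case: (a y); case: (b y) => /=; lia. Qed.

Lemma count_eq1 (a : pred nat) (s : seq nat) : count a s = 1 ->
  exists2 x, x \in s /\ a x & forall y, y \in s -> a y -> y = x.
Proof.
rewrite -size_filter; case E : (seq.filter a s) => [|x [|? ?]] // _.
have mem y : (y \in s) && a y = (y == x).
  by rewrite andbC -mem_filter E inE.
exists x; first by apply/andP; rewrite mem eqxx.
by move=> y ys ay; apply/eqP; rewrite -mem ys ay.
Qed.

Lemma count_ltn_iota (c n : nat) : c <= n ->
  count (fun i => i < c) (iota 0 n) = c.
Proof.
move=> cn; rewrite -{1}(subnKC cn) iotaD count_cat add0n.
rewrite (_ : count _ (iota 0 c) = c); last first.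
  rewrite -[RHS](size_iota 0 c); apply/eqP; rewrite -all_count.
  by apply/allP => i; rewrite mem_iota add0n.
rewrite (_ : count _ (iota c _) = 0) ?addn0 //.
apply/eqP; rewrite -leqn0 leqNgt -has_count; apply/hasPn => i.
by rewrite mem_iota; lia.
Qed.

(** A bijection carries as many points across the cut rightwards as leftwards. In particular the
    number of points keeping their side is odd. *)
Lemma crossing_balance (k : nat) (p : nat -> nat) (c : nat) :
  admissible k p -> c <= 2 * k ->
  count (fun i => (i <= c) && (p i <= c)) (iota 0 (2 * k).+1) + (2 * k - c) =
  c.+1 + count (fun i => (c < i) && (c < p i)) (iota 0 (2 * k).+1).
Proof.
move=> adm ck; set s := iota 0 _.
have e1 : count (fun i => p i <= c) s = c.+1.
  rewrite -[RHS](@count_ltn_iota c.+1 (2 * k).+1) // -/s.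
  have /permP /(_ (fun i => i < c.+1)) <- := admissible_perm adm.
  by rewrite count_map.
have e2 : count (fun i => i <= c) s = c.+1 by apply: (@count_ltn_iota c.+1).
have e3 := count_predC (fun i => i <= c) s; rewrite size_iota e2 in e3.
have e4 := count_split (fun i => p i <= c) (fun i => i <= c) s.
have e5 := count_split (fun i => c < i) (fun i => c < p i) s.
have e6 : count (fun i => c < i) s = count (predC (fun i => i <= c)) s.
  by apply: eq_count => i /=; rewrite ltnNge.
have e7 : count (fun i => (p i <= c) && (i <= c)) s =
          count (fun i => (i <= c) && (p i <= c)) s.
  by apply: eq_count => i; rewrite andbC.
have e8 : count (fun i => (p i <= c) && ~~ (i <= c)) s =
          count (fun i => (c < i) && ~~ (c < p i)) s.
  by apply: eq_count => i; rewrite andbC -ltnNge -leqNgt.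
lia.
Qed.

(* With indices starting at 0, the middle point is [k]. *)
Definition simple_pattern (k : nat) (p : nat -> nat) : Prop :=
  (exists x, [/\ x <= k, p x <= k, forall y, y <= k -> y <> x -> k < p y &
     forall y, k < y <= 2 * k -> p y <= k]) \/
  (exists x, [/\ k <= x <= 2 * k, k <= p x,
     forall y, k <= y <= 2 * k -> y <> x -> p y < k &
     forall y, y < k -> k <= p y]).

(* The case of three points outside [[lo, hi]] that keep their side, with
   [[l2, h2]], [[l1, h1]] and [[lo, hi]] the hulls [H_(2k-6)], [H_(2k-5)] and
   [H_(2k-4)] of [c, c+1]. *)
Record stuck (k : nat) (p : nat -> nat) (c l2 h2 l1 h1 lo hi : nat) : Prop := {
  stuck_lo : lo <= l1 <= l2;
  stuck_hi : h2 <= h1 <= hi;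
  stuck_hi_le : hi <= 2 * k;
  stuck_size2 : h2 = l2 + (2 * k - 5);
  stuck_size1 : h1 = l1 + (2 * k - 4);
  stuck_size : hi = lo + (2 * k - 3);
  stuck_center : c + 2 = lo + k;
  stuck_img2 : forall i, l2 <= i <= h2 -> l1 <= p i <= h1;
  stuck_img1 : forall i, l1 <= i <= h1 -> lo <= p i <= hi;
  stuck_in : forall i, lo <= i <= hi -> (i <= c) = (c < p i);
  stuck_out : forall i, i <= 2 * k -> i < lo \/ hi < i ->
    (i <= c) = (p i <= c) }.

(** The cut between [c] and [c + 1] is reflected to the one between [2 * k - 1 - c] and
    [2 * k - c]. *)
Lemma stuck_mirror (k : nat) (p : nat -> nat) (c l2 h2 l1 h1 lo hi : nat) :
  3 <= k -> admissible k p -> stuck k p c l2 h2 l1 h1 lo hi ->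
  stuck k (mirror k p) (2 * k - 1 - c) (2 * k - h2) (2 * k - l2)
    (2 * k - h1) (2 * k - l1) (2 * k - hi) (2 * k - lo).
Proof.
move=> k3 adm [h_lo h_hi hi_le s2 s1 s0 ce img2 img1 sw nsw].
have bnd := adm_bound adm; rewrite /mirror; split; try lia.
- by move=> i ?; have := img2 (2 * k - i); lia.
- by move=> i ?; have := img1 (2 * k - i); lia.
- by move=> i ?; have := sw (2 * k - i); have := bnd (2 * k - i); lia.
- by move=> i ik ?; have := nsw (2 * k - i); have := bnd (2 * k - i); lia.
Qed.

(** * Exclusion of three points that keep their side *)

Lemma covers_adj (p : nat -> nat) (i a b : nat) :
  p i <= a /\ b <= p i.+1 \/ p i.+1 <= a /\ b <= p i -> covers p i i.+1 a b.
Proof.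
by case=> [] [? ?]; [exists i, i.+1|exists i.+1, i]; rewrite !leqnn !leqnSn.
Qed.

(* Here [x] is the image of [2k], and [a], [b], [c] are those of [0], [1], [2]. *)
Lemma six_routes (x a b c : nat) : x < 3 ->
  a = 0 \/ b = 0 \/ c = 0 \/ x = 0 -> a = 1 \/ b = 1 \/ c = 1 \/ x = 1 ->
  a = 2 \/ b = 2 \/ c = 2 \/ x = 2 ->
  a <> 0 -> b <> 1 -> c <> 2 -> a <> b -> a <> c -> b <> c ->
  a <> x -> b <> x -> c <> x ->
  ~ (a = 1 /\ b = 0) -> ~ (a = 2 /\ c = 0) -> ~ (b = 2 /\ c = 1) ->
  x = 2 /\ (c = 0 /\ a = 1 /\ 3 <= b \/ c = 1 /\ b = 0 /\ 3 <= a) \/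
  x = 1 /\ (b = 0 /\ a = 2 /\ 3 <= c \/ b = 2 /\ c = 0 /\ 3 <= a) \/
  x = 0 /\ (a = 1 /\ b = 2 /\ 3 <= c \/ a = 2 /\ c = 1 /\ 3 <= b).
Proof. by case: x => [|[|[|]]] // _; case: a => [|[|[|a]]]; lia. Qed.

Lemma not_stuck_left (k : nat) (p : nat -> nat) (c l2 h2 l1 h1 lo hi : nat) :
  3 <= k -> admissible k p -> stuck k p c l2 h2 l1 h1 lo hi -> 2 <= lo -> False.
Proof.
move=> k3 adm [h_lo h_hi hi_le s2 s1 s0 ce img2 img1 sw nsw] lo2.
have bnd := adm_bound adm; have inj := adm_inj adm.
have onto j : j <= 2 * k -> exists2 i, i <= 2 * k & p i = j.
  exact: admissible_onto.
have inv (S : nat -> bool) i j : i <= 2 * k -> S i ->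
    (forall i, i <= 2 * k -> S i -> S (p i)) -> j <= 2 * k -> S j.
  by move=> ik Si HS jk; apply: (adm_cyclic adm) => //; exists i.
have nofix i := @admissible_no_fixpoint k p i ltac:(lia) adm.
(* A swapped pair among 0, 1, 2 is invariant but misses 3. *)
have no2 i j : i < 3 -> j < 3 -> p i = j -> p j = i -> False.
  move=> i3 j3 pi pj; have : (3 == i) || (3 == j); last by lia.
  apply: (inv (fun x => (x == i) || (x == j)) i); rewrite ?eqxx //; try lia.
  by move=> x _ /orP[] /eqP->; rewrite ?pi ?pj eqxx ?orbT.
have swE i : lo <= i <= hi -> i <= c /\ c < p i \/ c < i /\ p i <= c.
  by move=> /sw; case: (leqP i c); case: (ltnP c (p i)) => //; [left|right].
have nswE i : i <= 2 * k -> i < lo \/ hi < i ->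
    i <= c /\ p i <= c \/ c < i /\ c < p i.
  move=> ik /(nsw i ik).
  by case: (leqP i c); case: (leqP (p i) c) => //; [left|right].
have [i ik pi] := onto (2 * k) (leqnn _).
have i_in : lo <= i <= c.
  by have := nofix i ik; have := swE i; have := nswE i ik; lia.
have [lo3|loE] : lo = 3 \/ lo = 2 by lia.
- have ninv : ~ (forall i, 3 <= i <= 2 * k -> 3 <= p i).
    move=> H; have : 3 <= 0; last by [].
    apply: (inv (fun i => 3 <= i) 3) => //; first lia.
    by move=> j jk j3; apply: H; lia.
  (* If [l1 = 4], then [img1] sends 4, ..., [2 * k] into [[3, 2 * k]] and 3 crosses to the right, so
     this interval is invariant. *)
  have l1E : l1 = 3.
    have [//|l14] : l1 = 3 \/ l1 = 4 by lia.
    case: ninv => j j3k; have := img1 j; have := swE j; lia.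
  have p2k : p (2 * k) < 3.
    rewrite ltnNge; apply/negP => p2k; case: ninv => j j3k.
    have [->//|jk] := eqVneq j (2 * k); have := img1 j; lia.
  (* [[l2, h2]] maps below [2 * k] and reaches at least to [c], so the preimage [i] lies to its
     left, while [l2 <= 4]. *)
  have p3 : p 3 = 2 * k.
    by have i3 : i = 3 by [have := img2 i; lia]; rewrite -pi i3.
  have mid j : 3 <= j -> j < 2 * k -> 3 <= p j by move=> *; have := img1 j; lia.
  have pre j : j < 3 -> p 0 = j \/ p 1 = j \/ p 2 = j \/ p (2 * k) = j.
    move=> j3; have [x xk px] := onto j ltac:(lia).
    have [xE|x2k] := eqVneq x (2 * k); first by rewrite -xE; do 3!right.
    have x3 : x < 3 by have := mid x; lia.
    case: x x3 px {xk x2k} => [|[|[|]]] // _ px; first by left.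
      by right; left.
    by do 2!right; left.
  have ne a b : a < b -> b <= 2 * k -> p a <> p b.
    by move=> ab bk /inj; lia.
  have n01 := ne 0 1 isT ltac:(lia); have n02 := ne 0 2 isT ltac:(lia).
  have n12 := ne 1 2 isT ltac:(lia).
  have cases :
    p (2 * k) = 2 /\ (p 2 = 0 /\ p 0 = 1 /\ 3 <= p 1 \/
                     p 2 = 1 /\ p 1 = 0 /\ 3 <= p 0) \/
    p (2 * k) = 1 /\ (p 1 = 0 /\ p 0 = 2 /\ 3 <= p 2 \/
                     p 1 = 2 /\ p 2 = 0 /\ 3 <= p 0) \/
    p (2 * k) = 0 /\ (p 0 = 1 /\ p 1 = 2 /\ 3 <= p 2 \/
                     p 0 = 2 /\ p 2 = 1 /\ 3 <= p 1).
    have := ne 0 (2 * k); have := ne 1 (2 * k); have := ne 2 (2 * k).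
    move=> /(_ _ (leqnn _)) n2 /(_ _ (leqnn _)) n1 /(_ _ (leqnn _)) n0.
    apply: (six_routes p2k (pre 0 isT) (pre 1 isT) (pre 2 isT)) => //.
    - by apply: nofix.
    - by apply: nofix; lia.
    - by apply: nofix; lia.
    - by apply: n0; lia.
    - by apply: n1; lia.
    - by apply: n2; lia.
    - by case=> ? ?; apply: (no2 0 1).
    - by case=> ? ?; apply: (no2 0 2).
    - by case=> ? ?; apply: (no2 1 2).
  (* Distinct unit intervals share at most an endpoint, which [admissible_loop3] forbids. *)
  have loop a b d : a < 2 * k -> b < 2 * k -> d < 2 * k -> a < b \/ b < a ->
      covers p a a.+1 b b.+1 -> covers p b b.+1 d d.+1 ->
      covers p d d.+1 a a.+1 -> False.
    move=> ak bk dk ab cab cbd cda.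
    have := admissible_loop3 k3 adm _ _ _ cab cbd cda; lia.
  (* For the fifth order: [p 2 <= c < 2 * k - 1] and [p 3 = 2 * k] make [[2, 3]] cover the last unit
     interval. *)
  have := nswE 2 ltac:(lia) ltac:(lia).
  have p2k1 : 3 <= p (2 * k).-1 by apply: mid; lia.
  have k2E : (2 * k).-1.+1 = 2 * k by lia.
  (* The fourth and fifth orders use three distinct intervals; the other four go twice through an
     interval that covers itself. *)
  case: cases => [[e [[ea [eb ec]]|[ea [eb ec]]]]|
                 [[e [[ea [eb ec]]|[ea [eb ec]]]]|
                  [e [[ea [eb ec]]|[ea [eb ec]]]]]] p2c.
  - by apply: (loop 2 1 1); try lia; apply: covers_adj; lia.
  - by apply: (loop 1 0 0); try lia; apply: covers_adj; lia.
  - by apply: (loop 1 0 0); try lia; apply: covers_adj; lia.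
  - by apply: (loop 1 0 2); try lia; apply: covers_adj; lia.
  - by apply: (loop 1 2 (2 * k).-1); try lia;
      apply: covers_adj; rewrite ?k2E; lia.
  - by apply: (loop 2 1 1); try lia; apply: covers_adj; lia.
(* Here [[l1, h1]] maps below [2 * k] and reaches [c], so [i] lies to its left. Then only 0 and 1
   can have images below 2, and they are swapped. *)
- have l1E : l1 = 3 by have := img1 i; lia.
  have [i1 i1k p1] := onto 1 ltac:(lia); have [i0 i0k p0] := onto 0 ltac:(lia).
  have small j : j <= 2 * k -> p j < 2 -> j < 2.
    move=> jk pj; have := img1 j; have := swE j; have := nswE j jk.
    lia.
  apply: (no2 0 1) => //.
    have := small i1 i1k; have := nofix i1 i1k; rewrite p1.
    by case: i1 {i1k} p1 => [|[|]] //; lia.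
  have := small i0 i0k; have := nofix i0 i0k; rewrite p0.
  by case: i0 {i0k} p0 => [|[|]] //; lia.
Qed.

(** * Growth of the hulls around a cut *)

Section Cut.
Variables (k : nat) (p : nat -> nat) (c : nat).
Hypotheses (k3 : 3 <= k) (adm : admissible k p).
Hypotheses (ck : c < 2 * k) (pc : c < p c) (pSc : p c.+1 <= c).

Let H m := iter m (hull p) (c, c.+1).
Let HS m : H m.+1 = hull p (H m). Proof. by []. Qed.

(** Since [c] and [c + 1] cross the cut, the first hull contains both; taking hulls preserves
    inclusion. *)
Lemma hull_nested m : [/\ (H m).1 <= c, c < (H m).2 <= 2 * k,
  (H m.+1).1 <= (H m).1 & (H m).2 <= (H m.+1).2].
Proof.
elim: m => [|m [IH1 IH2 IH3 IH4]].
  have [//|h _ _] := @hullP p (c, c.+1).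
  have := h c; have := h c.+1; rewrite /H /=; split; lia.
have le1 : (H m).1 <= (H m).2 by lia.
have le2 : (H m.+1).1 <= (H m.+1).2 by lia.
have [hi1 [u hu pu] [v hv pv]] := hullP p le1.
have [hi2 [u' hu' pu'] [v' hv' pv']] := hullP p le2.
rewrite -!HS in hi1 pu pv hi2 pu' pv'.
have := hi2 u; have := hi2 v.
have := adm_bound adm (i := v); split; lia.
Qed.

Lemma hull_image m i : (H m).1 <= i <= (H m).2 ->
  (H m.+1).1 <= p i <= (H m.+1).2.
Proof.
have [h1 h2 _ _] := hull_nested m; have [|h _ _] := @hullP p (H m); first lia.
exact: h.
Qed.

Lemma hull_covers m a b : (H m.+1).1 <= a -> b <= (H m.+1).2 ->
  covers p (H m).1 (H m).2 a b.
Proof.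
move=> ha hb; have [h1 h2 _ _] := hull_nested m.
have [|_ [u hu pu] [v hv pv]] := @hullP p (H m); first lia.
by exists u, v; rewrite pu pv; split.
Qed.

(** By nestedness, a hull that stops growing is invariant, hence everything by [adm_cyclic]. *)
Lemma hull_grows m :
  H m = (0, 2 * k) \/ (H m).2 - (H m).1 < (H m.+1).2 - (H m.+1).1.
Proof.
have [h1 h2 h3 h4] := hull_nested m.
have [_|] := ltnP ((H m).2 - (H m).1) ((H m.+1).2 - (H m.+1).1); first by right.
move=> le; left.
have inv i : i <= 2 * k -> (H m).1 <= i <= (H m).2 ->
    (H m).1 <= p i <= (H m).2.
  by move=> _ /hull_image; lia.
have exc : exists2 i, i <= 2 * k & (H m).1 <= i <= (H m).2 by exists c; lia.
have all_in := adm_cyclic adm exc inv.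
have := all_in 0; have := all_in (2 * k).
by move=> a1 a2; apply: injective_projections => /=; lia.
Qed.

Lemma hull_size m : m < 2 * k -> m < (H m).2 - (H m).1.
Proof.
elim: m => [|m IH] mk; first by rewrite /H /=; lia.
have [E|] := hull_grows m; last by have := IH; lia.
by have [] := hull_nested m; rewrite E /=; lia.
Qed.

(** The loop [H 0, ..., H (m - 1), [y, y + 1], [c, c + 1]] has odd length [m + 1 = 2 * k - 3]. Its
    last two intervals must overlap, so [y = c], against [c < p c]. *)
Lemma admissible_only_center y : let m := 2 * k - 4 in
  (H m).1 <= y -> y < (H m).2 -> p y <= c -> c < p y.+1 -> False.
Proof.
move=> m my ym py pSy.
pose lo t := if t < m then (H t).1 else if t == m then y else c.
pose hi t := if t < m then (H t).2 else if t == m then y.+1 else c.+1.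
have m0 : 0 < m by rewrite /m; lia.
have loS : lo m.+1 = c by rewrite /lo ltnNge leqnSn gtn_eqF.
have hiS : hi m.+1 = c.+1 by rewrite /hi ltnNge leqnSn gtn_eqF.
have lom : lo m = y by rewrite /lo ltnn eqxx.
have him : hi m = y.+1 by rewrite /hi ltnn eqxx.
have overlap : forall s t, s <= m.+1 -> t <= m.+1 -> lo t < hi s.
  apply: (@adm_loop _ _ adm m.+1 lo hi); rewrite ?loS ?hiS /lo /hi ?m0 //.
  - by rewrite /= /m; lia.
  - by rewrite /m; lia.
  - move=> t tm; have [h1 h2 _ _] := hull_nested t.
    have [h3 h4 _ _] := hull_nested m.
    by case: ifP => _; [lia|case: ifP => _; lia].
  - move=> t; rewrite -/(lo t) -/(hi t) -/(lo t.+1) -/(hi t.+1) ltnS leq_eqVlt.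
    case/predU1P=> [->|tm].
      by rewrite lom him loS hiS; exists y, y.+1; rewrite !leqnn !leqnSn.
    rewrite {1}/lo {1}/hi tm; move: tm; rewrite leq_eqVlt => /predU1P[tm|tm].
      by apply: hull_covers; rewrite tm ?lom ?him.
    by apply: hull_covers; rewrite /lo /hi tm.
have := overlap m m.+1 (leqnSn _) (leqnn _).
have := overlap m.+1 m (leqnn _) (leqnSn _).
rewrite lom him loS hiS => h1 h2.
have yc : y = c by lia.
by move: py; rewrite yc; lia.
Qed.

Lemma crossing x z : x <= z -> p x <= c -> c < p z ->
  exists y, [/\ x <= y, y < z, p y <= c & c < p y.+1].
Proof.
move=> + px; elim: z => [|z IH] xz pz.
  by have xE : x = 0 by [lia]; move: px; rewrite xE; lia.
have [pz'|pz'] := ltnP c (p z).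
  have [|//|y [h1 h2 h3 h4]] := IH.
    by move: xz px; rewrite leq_eqVlt => /predU1P[->|//]; lia.
  by exists y; split=> //; lia.
exists z; split=> //.
by have : x <> z.+1 by [move=> xE; move: px; rewrite xE; lia]; lia.
Qed.

(** The image of [c] is on the right and that of [c + 1] on the left, so a point keeping its side
    leaves, between it and the nearer of the two, neighbours whose images cross upward. *)
Lemma hull_switches i : let m := 2 * k - 4 in
  (H m).1 <= i <= (H m).2 -> (i <= c) = (c < p i).
Proof.
move=> m im; have [h1 h2 _ _] := hull_nested m.
have [ic|ci] := leqP i c; have [pi|pi] := ltnP c (p i) => //; exfalso.
- have [y [iy yc py pSy]] := crossing ic pi pc.
  by apply: (@admissible_only_center y) => //; rewrite -/m; lia.
- have [y [iy yc py pSy]] := crossing ci pSc pi.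
  by apply: (@admissible_only_center y) => //; rewrite -/m; lia.
Qed.

Lemma simple_or_stuck : simple_pattern k p \/
  exists l2 h2 l1 h1 lo hi, stuck k p c l2 h2 l1 h1 lo hi.
Proof.
pose m := 2 * k - 6; have mE : 2 * k - 4 = m.+2 by rewrite /m; lia.
have sw := hull_switches; rewrite /= mE in sw.
have bal := crossing_balance adm (ltnW ck).
set s := iota 0 _ in bal; have mem_s i : (i \in s) = (i <= 2 * k).
  by rewrite mem_iota add0n ltnS.
pose nsl i := (i <= c) && (p i <= c); pose nsr i := (c < i) && (c < p i).
rewrite -/nsl -/nsr in bal.
have [a0 a1 n2lo n2hi] := hull_nested m.
have [b0 b1 n1lo n1hi] := hull_nested m.+1.
have [d0 d1 _ _] := hull_nested m.+2.
have subl x : x \in s -> nsl x -> x < (H m.+2).1.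
  by rewrite mem_s => xk /andP[xc px]; have := sw x; lia.
have subr x : x \in s -> nsr x -> (H m.+2).2 < x.
  by rewrite mem_s => xk /andP[xc px]; have := sw x; lia.
(* Points keeping their side lie outside the last hull, which misses at most three points. The
   equality cases [eql] and [eqr] serve when all three keep their side. *)
have [lel eql] := count_sub subl; have [ler eqr] := count_sub subr.
rewrite count_ltn_iota in lel eql; last lia.
have cr : count (fun i => (H m.+2).2 < i) s = 2 * k - (H m.+2).2.
  have := count_predC (fun i => i < (H m.+2).2.+1) s.
  rewrite size_iota count_ltn_iota; last lia.
  rewrite (@eq_count _ (predC _) (fun i => (H m.+2).2 < i)); first lia.
  by move=> i /=; rewrite -leqNgt.
rewrite cr in ler eqr.
have size_m2 : m.+2 < (H m.+2).2 - (H m.+2).1 by apply: hull_size; lia.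
have [n1|n1] := leqP (count nsl s + count nsr s) 1.
  (* By [bal] the total is odd, hence one; the side of that point decides whether [c] is [k] or
     [k - 1]. *)
  left; have [[cl cr0 cE]|[cl cr1 cE]] :
      [/\ count nsl s = 1, count nsr s = 0 & c = k] \/
      [/\ count nsl s = 0, count nsr s = 1 & c.+1 = k].
    by case: (count nsl s) (count nsr s) n1 bal => [|[|?]] [|[|?]] //= _ bal;
      try lia; [right|left]; split=> //; lia.
  - left; have [x [xs xl] xu] := count_eq1 cl.
    move: xl; rewrite /nsl cE => /andP[xk pxk].
    exists x; split=> // y yk.
      move=> yx; rewrite ltnNge; apply/negP => pyk; apply: yx; apply: xu.
        by rewrite mem_s; lia.
      by rewrite /nsl cE yk pyk.
    rewrite leqNgt; apply/negP => pyk.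
    have : has nsr s by apply/hasP; exists y; rewrite ?mem_s /nsr ?cE; lia.
    by rewrite has_count cr0.
  - right; have [x [xs xl] xu] := count_eq1 cr1.
    move: xs xl; rewrite mem_s /nsr cE => xs /andP[xk pxk].
    exists x; split=> //; first by rewrite xk.
      move=> y yk yx; rewrite ltnNge; apply/negP => pyk; apply: yx; apply: xu.
        by rewrite mem_s; lia.
      by rewrite /nsr cE pyk; lia.
    move=> y yk; rewrite leqNgt; apply/negP => pyk.
    have : has nsl s by apply/hasP; exists y; rewrite ?mem_s /nsl; lia.
    by rewrite has_count cl.
(* The total is now three, so both bounds are attained. The hull lengths, strictly increasing from
   at least [2 * k - 5] to [2 * k - 3], are thereby determined. *)
right; have el : count nsl s = (H m.+2).1 by lia.
have er : count nsr s = 2 * k - (H m.+2).2 by lia.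
have g1 : (H m).2 - (H m).1 < (H m.+1).2 - (H m.+1).1.
  have [E|//] := hull_grows m; have E1 : (H m).1 = 0 by rewrite E.
  by have E2 : (H m).2 = 2 * k by [rewrite E]; lia.
have g2 : (H m.+1).2 - (H m.+1).1 < (H m.+2).2 - (H m.+2).1.
  have [E|//] := hull_grows m.+1; have E1 : (H m.+1).1 = 0 by rewrite E.
  by have E2 : (H m.+1).2 = 2 * k by [rewrite E]; lia.
have size_m : m < (H m).2 - (H m).1 by apply: hull_size; lia.
exists (H m).1, (H m).2, (H m.+1).1, (H m.+1).2, (H m.+2).1, (H m.+2).2.
split; try lia.
- exact: hull_image.
- exact: hull_image.
- exact: sw.
- move=> i ik [ilo|hii].
    by have := eql el i; rewrite mem_s ik ilo /nsl => /(_ isT isT) /andP[-> ->].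
  have := eqr er i; rewrite mem_s ik hii /nsr => /(_ isT isT) /andP[ci cpi].
  by rewrite (leqNgt i) (leqNgt (p i)) ci cpi.
Qed.

End Cut.

(** The largest point moved to the right works: its successor is neither moved right nor fixed. *)
Lemma exists_cut (k : nat) (p : nat -> nat) : 0 < k -> admissible k p ->
  exists c, [/\ c < 2 * k, c < p c & p c.+1 <= c].
Proof.
move=> k0 adm; have bnd := adm_bound adm.
have nofix i := @admissible_no_fixpoint k p i ltac:(lia) adm.
have ex : exists c, (c < 2 * k) && (c < p c).
  by exists 0; have := nofix 0; lia.
have ub c : (c < 2 * k) && (c < p c) -> c <= 2 * k by lia.
have [c /andP[ck pc] cmax] := ex_maxnP ex ub.
exists c; split=> //; have := nofix c.+1; have := bnd c.+1; have := cmax c.+1.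
lia.
Qed.

Lemma admissible_simple (k : nat) (p : nat -> nat) :
  3 <= k -> admissible k p -> simple_pattern k p.
Proof.
move=> k3 adm; have [c [ck pc pSc]] := @exists_cut k p ltac:(lia) adm.
have [//|[l2 [h2 [l1 [h1 [lo [hi st]]]]]]] := simple_or_stuck k3 adm ck pc pSc.
(* Of the three points outside [[lo, hi]], two lie on the same side. *)
exfalso; have [lo2|lo2] := leqP 2 lo.
  exact: (not_stuck_left k3 adm st lo2).
apply: (not_stuck_left k3 (admissible_mirror adm) (stuck_mirror k3 adm st)).
have := stuck_hi_le st; have := stuck_size st; lia.
Qed.

Local Open Scope classical_set_scope.
Local Open Scope ring_scope.


(** * Periodic points from loops of covering intervals *)

(** Compactness provides the last and first points of level sets chosen in
    [itv_image_exact_incr]. *)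
Lemma compact_level_set (R : realType) (f : R -> R) (a b c : R) :
  {within `[a, b], continuous f} -> compact [set x | a <= x <= b /\ f x = c].
Proof.
move=> /continuous_closedP /(_ [set c]) cf.
have /closed_subspaceP [V clV VE] := cf (closed_eq (y := c)).
have -> : [set x | a <= x <= b /\ f x = c] = V `&` `[a, b].
  rewrite VE; apply/seteqP; split=> x /=.
    by move=> [h1 h2]; split=> //; rewrite in_itv.
  by rewrite in_itv => -[].
rewrite setIC.
exact: compact_closedI (@segment_compact _ a b) clV.
Qed.

(** Take for [a] the last point of [[u, v]] at level [c], and for [b] the first point after [a] at
    level [d]; in between, leaving [[c, d]] would produce another such point. *)
Lemma itv_image_exact_incr (R : realType) (f : R -> R) (u v c d : R) :
  u <= v -> {within `[u, v], continuous f} -> c <= d -> f u <= c -> d <= f v ->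
  exists a b, [/\ u <= a, a <= b, b <= v, f a = c /\ f b = d &
    forall x, a <= x <= b -> c <= f x <= d].
Proof.
move=> uv cf cd fuc dfv.
have cfs a b : u <= a -> b <= v -> {within `[a, b], continuous f}.
  move=> ua bv; apply: continuous_subspaceW cf => x /=.
  by rewrite !in_itv /= => /andP[ax xb]; rewrite (le_trans ua ax) (le_trans xb bv).
have ivt a b e : u <= a -> a <= b -> b <= v -> f a <= e -> e <= f b ->
    exists2 x, a <= x <= b & f x = e.
  move=> ua ab bv fae efb; have [|x] := IVT (v := e) ab (cfs a b ua bv).
    by rewrite ge_min fae /= le_max efb orbT.
  by rewrite in_itv /=; exists x.
have cid A : {within A, continuous (id : R -> R)}.
  by apply: continuous_subspaceT => x; exact: cvg_id.
have [x0 x0uv fx0] := ivt u v c (lexx _) uv (lexx _) fuc (le_trans cd dfv).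
have [||a /set_mem [/andP[ua av] fa] amax] :=
    compact_EVT_max (A := [set x | u <= x <= v /\ f x = c]) _ _ (cid _).
- by exists x0.
- exact: compact_level_set.
have fac t : a < t -> t <= v -> c <= f t.
  move=> lt_at tv; rewrite leNgt; apply/negP => ftc.
  have ut := le_trans ua (ltW lt_at).
  have [x /andP[tx xv] fx] := ivt t v c ut tv (lexx _) (ltW ftc) (le_trans cd dfv).
  have : x <= a by apply: amax; rewrite inE /= (le_trans ut tx) xv.
  by rewrite leNgt (lt_le_trans lt_at tx).
have [x1 x1av fx1] : exists2 x, a <= x <= v & f x = d.
  by apply: ivt => //; rewrite fa.
have [||b /set_mem [/andP[ab bv] fb] bmin] :=
    compact_EVT_min (A := [set x | a <= x <= v /\ f x = d]) _ _ (cid _).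
- by exists x1.
- by apply: compact_level_set; apply: cfs.
exists a, b; split=> // x /andP[ax xb]; apply/andP; split.
  move: ax; rewrite le_eqVlt => /predU1P[<-|ax]; first by rewrite fa.
  by apply: fac => //; exact: le_trans xb bv.
rewrite leNgt; apply/negP => dfx.
have [||y /andP[ay yx] fy] := ivt a x d ua ax (le_trans xb bv).
- by rewrite fa.
- exact: ltW.
have yv := le_trans yx (le_trans xb bv).
have by_ : b <= y by apply: bmin; rewrite inE /= ay yv.
have xy : x = y by apply/le_anti; rewrite yx (le_trans xb by_).
by move: dfx; rewrite xy fy ltxx.
Qed.

Lemma itv_image_exact (R : realType) (f : R -> R) (p q u v c d : R) :
  {within `[p, q], continuous f} -> p <= u <= q -> p <= v <= q ->
  c <= d -> f u <= c -> d <= f v ->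
  exists a b, [/\ p <= a, a <= b, b <= q,
    f a = c /\ f b = d \/ f a = d /\ f b = c &
    forall x, a <= x <= b -> c <= f x <= d].
Proof.
move=> cf /andP[pu uq] /andP[pv vq] cd fuc dfv.
have cfs a b : p <= a -> b <= q -> {within `[a, b], continuous f}.
  move=> pa bq; apply: continuous_subspaceW cf => x /=.
  by rewrite !in_itv /= => /andP[ax xb]; rewrite (le_trans pa ax) (le_trans xb bq).
have [uv|/ltW vu] := leP u v.
  have [a [b [ua ab bv fab H]]] :=
    itv_image_exact_incr uv (cfs _ _ pu vq) cd fuc dfv.
  by exists a, b; split=> //; [exact: le_trans ua|exact: le_trans bv _|left].
(* When [v] precedes [u], the increasing case applies to [- f] with levels [- d] and [- c]. *)
have cNf : {within `[v, u], continuous (- f)}.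
  by move=> x; apply: continuousN => ?; exact: cfs.
have [|||a [b [va ab bu [fa fb] H]]] :=
    itv_image_exact_incr (c := - d) (d := - c) vu cNf; try by rewrite lerN2.
exists a, b; split=> //; first exact: le_trans va.
- exact: le_trans bu _.
- by right; split; apply: oppr_inj.
- by move=> x /H; rewrite !lerN2 andbC.
Qed.

Lemma continuous_within_iter (R : realType) (I : set R) (f : R -> R) (m : nat) :
  set_fun I I f -> {within I, continuous f} -> {within I, continuous (iter m f)}.
Proof.
move=> fI cf.
have iI n x : I x -> I (iter n f x) by elim: n => //= n IH /IH /fI.
elim: m => [|m IH]; first by apply: continuous_subspaceT => x; exact: cvg_id.
apply/subspace_continuousP => x Ix.
have /subspace_continuousP /(_ x Ix) h1 := IH.
have /subspace_continuousP /(_ _ (iI m x Ix)) h2 := cf.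
rewrite (_ : iter m.+1 f = f \o iter m f) //.
apply: (cvg_comp _ _ _ h2) => A; rewrite /within /= => nA.
have /= := h1 _ nA; rewrite /nbhs /= /within /=.
apply: filterS => y h Iy; apply: h => //; exact: iI.
Qed.

(** An interval following the tail of the itinerary is pulled back exactly into the first interval.
    Each pullback may reverse orientation, hence the final disjunction. *)
Lemma covering_chain (R : realType) (I : set R) (f : R -> R) (m : nat)
    (a b : nat -> R) :
  {within I, continuous f} ->
  (forall t, (t <= m)%N -> a t <= b t) ->
  (forall t, (t <= m)%N -> `[a t, b t] `<=` I) ->
  (forall t, (t < m)%N -> exists u v,
     [/\ a t <= u <= b t, a t <= v <= b t, f u <= a t.+1 & b t.+1 <= f v]) ->
  exists x y, [/\ a 0%N <= x, x <= y, y <= b 0%N,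
    (forall t z, (t <= m)%N -> x <= z <= y -> a t <= iter t f z <= b t) &
    iter m f x = a m /\ iter m f y = b m \/
    iter m f x = b m /\ iter m f y = a m].
Proof.
move=> cf; elim: m a b => [|m IH] a b ab abI cov.
  exists (a 0%N), (b 0%N); split=> //; [exact: ab | | by left].
  by case.
have [|||x [y [ax xy yb H E]]] := IH (fun t => a t.+1) (fun t => b t.+1).
- by move=> t tm; apply: ab.
- by move=> t tm; apply: abI.
- by move=> t tm; apply: cov.
have [u [v [uab vab fu fv]]] := cov 0%N isT.
have cf0 : {within `[a 0%N, b 0%N], continuous f}.
  by apply: continuous_subspaceW cf; apply: abI.
have [x' [y' [ax' xy' yb' E' H']]] := itv_image_exact cf0 uab vab xy
   (le_trans fu ax) (le_trans yb fv).
exists x', y'; split=> //.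
  move=> [|t] z tm zxy /=.
    case/andP: zxy => xz zy.
    by rewrite (le_trans ax' xz) (le_trans zy yb').
  by rewrite -iterS iterSr; apply: H => //; exact: H'.
rewrite !iterSr; case: E' => [] [-> ->]; case: E => [] [-> ->]; by [left|right].
Qed.

(** On the interval from [covering_chain], [iter m f] sends the endpoints to the ends of a larger
    interval, so [iter m f z - z] changes sign. *)
Lemma covering_loop (R : realType) (I : set R) (f : R -> R) (m : nat)
    (a b : nat -> R) :
  set_fun I I f -> {within I, continuous f} ->
  (forall t, (t <= m)%N -> a t <= b t) ->
  (forall t, (t <= m)%N -> `[a t, b t] `<=` I) ->
  (forall t, (t < m)%N -> exists u v,
     [/\ a t <= u <= b t, a t <= v <= b t, f u <= a t.+1 & b t.+1 <= f v]) ->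
  a m = a 0%N -> b m = b 0%N ->
  exists2 x, iter m f x = x &
    forall t, (t <= m)%N -> a t <= iter t f x <= b t.
Proof.
move=> fI cf ab abI cov am bm.
have [x [y [ax xy yb H E]]] := covering_chain cf ab abI cov.
have cg : {within `[x, y], continuous (fun z => iter m f z - z)}.
  have sub : `[x, y] `<=` I.
    move=> z /=; rewrite in_itv /= => /andP[xz zy]; apply: (abI 0%N) => //=.
    by rewrite in_itv /= (le_trans ax xz) (le_trans zy yb).
  have c1 : {within `[x, y], continuous (iter m f)}.
    by apply: (continuous_subspaceW sub); exact: continuous_within_iter.
  have c2 : {within `[x, y], continuous (id : R -> R)}.
    by apply: continuous_subspaceT => z; exact: cvg_id.
  move=> z; apply: (@continuousB _ _ _ (iter m f : subspace `[x, y] -> R) id z).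
    exact: c1.
  exact: c2.
have [|z] := IVT (v := 0) xy cg.
  rewrite ge_min le_max !subr_le0 !subr_ge0; case: E => [] [-> ->]; rewrite am bm.
    by rewrite ax yb orbT.
  by rewrite (le_trans ax xy) (le_trans xy yb) orbT.
rewrite in_itv /= => zxy /eqP; rewrite subr_eq0 => /eqP zE.
by exists z => // t tm; apply: H.
Qed.

(** The least return time divides [q], hence is odd, and it is not 1 because [x] is not fixed. *)
Lemma period_in_of_odd_return (R : realType) (I : set R) (f : R -> R)
    (J : set R) (q : nat) (x : R) :
  odd q -> I x -> iter q f x = x -> f x <> x ->
  (forall t, (t < q)%N -> J (iter t f x)) ->
  exists d, [/\ odd d, (1 < d <= q)%N & period_in I f J d].
Proof.
move=> oq Ix fq fx HJ.
have ex : exists d, (0 < d)%N && (iter d f x == x).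
  by exists q; rewrite fq eqxx odd_gt0.
have [d /andP[d0 /eqP fd] dmin] := ex_minnP ex.
have iterM a : iter (a * d) f x = x.
  by elim: a => // a IH; rewrite mulSn iterD IH.
have dq : (d %| q)%N.
  rewrite /dvdn; apply/negPn/negP; rewrite -lt0n => r0.
  have : (d <= q %% d)%N.
    apply: dmin; rewrite r0 /=; apply/eqP.
    by rewrite -[RHS]fq {2}(divn_eq q d) addnC iterD iterM.
  by rewrite leqNgt ltn_mod d0.
have dleq : (d <= q)%N by apply: dvdn_leq => //; rewrite odd_gt0.
exists d; split.
- by case/dvdnP: dq oq => e ->; rewrite oddM => /andP[].
- rewrite dleq andbT; case: d d0 fd {dmin iterM dq dleq} => [|[|]] //.
- exists [set iter j f x | j in [set j : nat | (j < d)%N]].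
    exists x => //; split=> // l /andP[l0 ld] fl.
    by have := dmin l; rewrite l0 fl eqxx => /(_ isT); rewrite leqNgt ld.
  by move=> _ [j /= jd <-]; apply: HJ; exact: leq_trans jd dleq.
Qed.

(** * From the orbit to its permutation *)

Section Bridge.
Variables (R : realType) (k : nat) (I : set R) (f : R -> R).
Variable beta : 'I_(2 * k).+1 -> R.
Hypotheses (k3 : (3 <= k)%N) (I_itv : is_interval I) (fI : set_fun I I f).
Hypothesis cf : {within I, continuous f}.
Hypothesis beta_mono : {homo beta : i j / (i < j)%N >-> i < j}.
Hypothesis beta_orbit : is_orbit I f (2 * k).+1 (range beta).

Let b (i : nat) : R := beta (inord i).

Let b_lt i j : (i < j)%N -> (j <= 2 * k)%N -> b i < b j.
Proof. by move=> ij jk; apply: beta_mono; rewrite !inordK //; lia. Qed.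

Let b_le i j : (i <= j)%N -> (j <= 2 * k)%N -> b i <= b j.
Proof.
by rewrite leq_eqVlt => /predU1P[->//|ij] jk; exact: ltW (b_lt ij jk).
Qed.

Let b_inj i j : (i <= 2 * k)%N -> (j <= 2 * k)%N -> b i = b j -> i = j.
Proof.
move=> ik jk bij; case: (ltngtP i j) => // ij.
  by have := b_lt ij jk; rewrite bij ltxx.
by have := b_lt ij ik; rewrite bij ltxx.
Qed.

Lemma orbit_point : exists c, [/\ I c, iter (2 * k).+1 f c = c, f c <> c,
  forall i, exists2 a, (a < (2 * k).+1)%N & b i = iter a f c &
  forall a, exists2 i, (i <= 2 * k)%N & iter a f c = b i].
Proof.
have [c [Ic _ fn fl] rng] := beta_orbit.
exists c; split=> //.
- by apply: (fl 1%N); lia.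
- move=> i; have : range beta (b i) by exists (inord i).
  by rewrite rng => -[a /= an <-]; exists a.
- move=> a; have : range beta (iter a f c).
    rewrite rng; exists (a %% (2 * k).+1)%N => /=; first exact: ltn_pmod.
    rewrite [in RHS](divn_eq a (2 * k).+1) addnC iterD; congr (iter _ _ _).
    by elim: (a %/ _)%N => // e IH; rewrite mulSn iterD -IH.
  by case=> i _ <-; exists i; rewrite /b ?inord_val // -ltnS.
Qed.

Lemma orbit_pattern : exists p : nat -> nat,
  forall i, (i <= 2 * k)%N -> (p i <= 2 * k)%N /\ f (b i) = b (p i).
Proof.
have [c [_ _ _ orb back]] := orbit_point.
have next i : exists j, (j <= 2 * k)%N /\ f (b i) = b j.
  by have [a _ ->] := orb i; have [j jk e] := back a.+1; exists j.
by have [p pP] := choice next; exists p => i _; exact: pP.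
Qed.

Hypothesis no_odd : forall q : nat, odd q -> (1 < q < 2 * k - 1)%N ->
  ~ period_in I f `[beta ord0, beta ord_max] q.

Lemma orbit_pattern_admissible (p : nat -> nat) :
  (forall i, (i <= 2 * k)%N -> (p i <= 2 * k)%N /\ f (b i) = b (p i)) ->
  admissible k p.
Proof.
move=> fb; have [c [Ic fn fc orb back]] := orbit_point.
have iterI a x : I x -> I (iter a f x) by move=> Ix; elim: a => //= a /fI.
have bI i : I (b i) by have [a _ ->] := orb i; exact: iterI.
have iter_c a i : (a <= (2 * k).+1)%N -> b i = iter a f c ->
    iter ((2 * k).+1 - a) f (b i) = c.
  by move=> an ->; rewrite -iterD subnK.
split.
- by move=> i /fb[].
- move=> i j ik jk pij; apply: b_inj => //.
  (* On the orbit, [iter (2 * k) f] is a left inverse of [f]. *)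
  have bn l : iter (2 * k) f (f (b l)) = b l.
    by have [a _ ->] := orb l; rewrite -iterSr -iterD addnC iterD fn.
  by rewrite -(bn i) -(bn j) (proj2 (fb i ik)) (proj2 (fb j jk)) pij.
- move=> S [i ik Si] HS j jk.
  have reach t : exists l, [/\ (l <= 2 * k)%N, S l & iter t f (b i) = b l].
    elim: t => [|t [l [lk Sl e]]]; first by exists i.
    have [pk fl] := fb l lk.
    by exists (p l); split=> //; [exact: HS|rewrite iterS e].
  have [a an ai] := orb i; have [a' _ aj] := orb j.
  (* From [b i], the first [(2 * k).+1 - a] steps lead to [c], and [a'] more lead to [b j]. *)
  have [l [lk Sl]] := reach (a' + ((2 * k).+1 - a))%N.
  by rewrite iterD (iter_c a i (ltnW an) ai) -aj => /b_inj ->.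
- move=> q lo hi oq qk lohi cov loq hiq s t sq tq.
  have sub r : (r <= q)%N -> `[b (lo r), b (hi r)] `<=` I.
    move=> rq x /=; rewrite in_itv /= => xr.
    exact: (I_itv (bI (lo r)) (bI (hi r))).
  have [||x fx xr] := covering_loop fI cf (m := q) (a := fun r => b (lo r))
    (b := fun r => b (hi r)) _ sub _ (congr1 b loq) (congr1 b hiq).
  + by move=> r rq; apply: b_le; have := lohi r rq; lia.
  + move=> r rq; have [u [v [hu hv pu pv]]] := cov r rq.
    have h1 := lohi r (ltnW rq); have h2 := lohi r.+1 rq.
    have [uk vk] : (u <= 2 * k)%N /\ (v <= 2 * k)%N by lia.
    exists (b u), (b v); split.
    * by apply/andP; split; apply: b_le; lia.
    * by apply/andP; split; apply: b_le; lia.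
    * by rewrite (proj2 (fb u uk)); apply: b_le => //; lia.
    * by rewrite (proj2 (fb v vk)); apply: b_le => //; have [] := fb v vk.
  have xJ r : (r <= q)%N -> b 0 <= iter r f x <= b (2 * k).
    move=> rq; have /andP[x1 x2] := xr r rq; have h := lohi r rq.
    apply/andP; split; first by apply: le_trans x1; apply: b_le; lia.
    by apply: le_trans x2 _; apply: b_le; lia.
  rewrite ltnNge; apply/negP => hl.
  (* A fixed [x] lies in both intervals, which meet in at most an endpoint. It is thus an orbit
     point, and iterating it to [c] makes [c] fixed. *)
  have [ffx|ffx] := eqVneq (f x) x.
    have fixed r : iter r f x = x by elim: r => //= r ->.
    have xE : x = b (lo t).
      have /andP[x1 _] := xr t tq; have /andP[_ x2] := xr s sq.
      rewrite !fixed in x1 x2; apply/le_anti; rewrite x1 andbT.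
      by apply: le_trans x2 _; apply: b_le => //; have := lohi t tq; lia.
    have [a an ae] := orb (lo t); have := iter_c a (lo t) (ltnW an) ae.
    by rewrite -xE fixed => xc; apply: fc; rewrite -xc.
  have Ix : I x.
    by apply: (sub 0%N) => //=; rewrite in_itv /=; apply: (xr 0%N).
  have [||d [od dq pd]] :=
      period_in_of_odd_return (J := `[beta ord0, beta ord_max]) oq Ix fx.
  + exact/eqP.
  + move=> r rq /=; rewrite in_itv /=.
    have -> : beta ord0 = b 0 by congr beta; apply/val_inj; rewrite /= inordK.
    have -> : beta ord_max = b (2 * k).
      by congr beta; apply/val_inj; rewrite /= inordK.
    exact: xJ (ltnW rq).
  by apply: (no_odd od _ pd); lia.
Qed.

(** Pattern indices start at 0 and those of [block] at 1: the indices [l <= k] form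
    [block beta 1 (k + 1)]. *)
Lemma simple_pattern_orbit (p : nat -> nat) :
  (forall i, (i <= 2 * k)%N -> (p i <= 2 * k)%N /\ f (b i) = b (p i)) ->
  simple_pattern k p -> simple_orbit f beta.
Proof.
move=> fb.
have ord (l : 'I_(2 * k).+1) : (l <= 2 * k)%N by rewrite -ltnS.
have bE (l : 'I_(2 * k).+1) : beta l = b l by rewrite /b inord_val.
have in_block i j l : (i <= l.+1 <= j)%N -> (l <= 2 * k)%N -> block beta i j (b l).
  by move=> il lk; exists (inord l) => //=; rewrite inordK.
have blockE i j y : block beta i j y ->
    exists l, [/\ (i <= l.+1 <= j)%N, (l <= 2 * k)%N & y = b l].
  by move=> [l /= il <-]; exists l; rewrite ord bE.
case=> [[x [xk pxk H1 H2]]|[x [xk pxk H1 H2]]]; [left|right]; split.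
- move=> _ /blockE[l [il lk ->]]; have [plk ->] := fb l lk.
  by apply: in_block => //; have := H2 l; lia.
- have xk2 : (x <= 2 * k)%N by lia.
  have [pxk2 fx] := fb x xk2; exists (b x); split.
  + by apply: in_block => //; lia.
  + by rewrite fx => /blockE[l [il lk /b_inj]]; lia.
  + move=> _ /blockE[l [il lk ->]] lx; have [plk ->] := fb l lk.
    apply: in_block => //; have := H1 l.
    have : l <> x by [move=> e; apply: lx; rewrite e]; lia.
- move=> _ /blockE[l [il lk ->]]; have [plk ->] := fb l lk.
  by apply: in_block => //; have := H2 l; lia.
- have xk2 : (x <= 2 * k)%N by lia.
  have [pxk2 fx] := fb x xk2; exists (b x); split.
  + by apply: in_block => //; lia.
  + by rewrite fx => /blockE[l [il lk /b_inj]]; lia.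
  + move=> _ /blockE[l [il lk ->]] lx; have [plk ->] := fb l lk.
    apply: in_block => //; have := H1 l.
    have : l <> x by [move=> e; apply: lx; rewrite e]; lia.
Qed.

End Bridge.

Theorem theorem1p12 (R : realType) (k : nat) (hk : (3 <= k)%N)
    (I : set R) (I_itv : is_interval I)
    (I_nondeg : exists a b : R, [/\ I a, I b & a < b])
    (f : R -> R) (f_I : set_fun I I f) (f_cont : {within I, continuous f})
    (beta : 'I_(2 * k).+1 -> R) :
  second_minimal I f beta -> simple_orbit f beta.
Proof.
case=> _ [beta_mono beta_orbit] /(sharkovski_minimal_periodE _ _ _ (ltnW hk)).
case=> _ no_odd; have [p fp] := orbit_pattern hk beta_orbit.
apply: (simple_pattern_orbit hk beta_mono fp); apply: admissible_simple => //.
exact: (orbit_pattern_admissible hk I_itv f_I f_cont beta_mono).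
Qed.
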